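(* Let $G$ be a cubic graph and let $F$ be a $2$-factor of $G$. Suppose that the odd cycles of $F$ can be partitioned into pairs $\{C_1,D_1\},\{C_2,D_2\},\ldots,\{C_k,D_k\}$ ($k\ge 0$) such that each pair $\{C_i,D_i\}$ is a good pair. Then $\tau(G)\le 4$; that is, the edge set of $G$ can be covered by at most $4$ perfect matchings.
   Context: For a bridgeless cubic graph $G$, the perfect matching index $\tau(G)$ is the minimum number of perfect matchings of $G$ whose union is $E(G)$. Let $C$ and $C'$ be two distinct odd cycles of a cubic graph $G$. The pair $\{C,C'\}$ is a good pair if there exist three distinct edges $xx'$, $yy'$, $zz'$ of $G$ with $x,y,z$ distinct vertices of $C$ and $x',y',z'$ distinct vertices of $C'$ such that the vertices $x,y,z$ divide $C$ into three edge-disjoint paths each of odd length, and the vertices $x',y',z'$ divide $C'$ into three edge-disjoint paths each of odd length. *)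

(* Defs.v *)
From mathcomp Require Import all_boot.

Set Implicit Arguments.
Unset Strict Implicit.
Unset Printing Implicit Defensive.

(* Finite graphs, with parallel edges and loops allowed.  The order of the two
   components of [ends e] is irrelevant: nothing below depends on it. *)
Record multigraph := Multigraph {
  vertex : finType;
  edge : finType;
  ends : edge -> vertex * vertex
}.

Definition joins (G : multigraph) (e : edge G) (x y : vertex G) : bool :=
  (ends e == (x, y)) || (ends e == (y, x)).

(* A loop contributes 2 to the degree of its vertex. *)
Definition degree (G : multigraph) (S : {set edge G}) (v : vertex G) : nat :=
  #|[set e in S | (ends e).1 == v]| + #|[set e in S | (ends e).2 == v]|.

Definition spanning_regular (G : multigraph) (r : nat) (S : {set edge G}) :
  bool := [forall v, degree S v == r].

Definition cubic (G : multigraph) : bool := spanning_regular 3 [set: edge G].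

Definition perfect_matching (G : multigraph) (M : {set edge G}) : bool :=
  spanning_regular 1 M.

Definition two_factor (G : multigraph) (F : {set edge G}) : bool :=
  spanning_regular 2 F.

(* A walk from x is the sequence of its steps (edge, vertex reached). *)
Fixpoint walk (G : multigraph) (x : vertex G) (p : seq (edge G * vertex G)) :
  bool :=
  if p is (e, y) :: p' then joins e x y && walk y p' else true.

Definition path_between (G : multigraph) (x y : vertex G)
    (p : seq (edge G * vertex G)) : bool :=
  [&& walk x p, last x (unzip2 p) == y & uniq (x :: unzip2 p)].

(* Distinctness of the edges matters only for length 2, where it forbids going
   back and forth along one edge. *)
Definition closed_path (G : multigraph) (x : vertex G)
    (p : seq (edge G * vertex G)) : bool :=
  [&& p != [::], walk x p, last x (unzip2 p) == x,
      uniq (unzip2 p) & uniq (unzip1 p)].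

(* Cycles are identified with their edge sets. *)
Definition is_cycle (G : multigraph) (C : {set edge G}) : Prop :=
  exists x p, closed_path x p /\ C = [set e in unzip1 p].

Definition odd_cycle (G : multigraph) (C : {set edge G}) : Prop :=
  is_cycle C /\ odd #|C|.

Definition on_cycle (G : multigraph) (C : {set edge G}) (x : vertex G) : bool :=
  [exists e in C, ((ends e).1 == x) || ((ends e).2 == x)].

Definition odd_division (G : multigraph) (C : {set edge G})
    (x y z : vertex G) : Prop :=
  [/\ uniq [:: x; y; z], on_cycle C x, on_cycle C y, on_cycle C z &
   exists p q r,
     [/\ path_between x y p, path_between y z q & path_between z x r] /\
     [/\ uniq (unzip1 (p ++ q ++ r)), C = [set e in unzip1 (p ++ q ++ r)],
         odd (size p), odd (size q) & odd (size r)]].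

Definition good_pair (G : multigraph) (C D : {set edge G}) : Prop :=
  [/\ odd_cycle C, odd_cycle D, C != D &
   exists x y z x' y' z' : vertex G,
     [/\ exists e1 e2 e3 : edge G,
           [/\ uniq [:: e1; e2; e3], joins e1 x x', joins e2 y y'
             & joins e3 z z'],
         odd_division C x y z & odd_division D x' y' z']].

(* As F is 2-regular, the cycles contained in F are its components. *)
Definition good_pairing (G : multigraph) (F : {set edge G})
    (P : {set {set {set edge G}}}) : Prop :=
  [/\ trivIset P,
      forall C : {set edge G}, C \in cover P <-> odd_cycle C /\ C \subset F
    & forall B : {set {set edge G}}, B \in P ->
        exists C D : {set edge G}, B = [set C; D] /\ good_pair C D].

Definition covered_by_perfect_matchings (G : multigraph) (n : nat) : Prop :=
  exists Ms : {set {set edge G}},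
    [/\ #|Ms| = n, forall M, M \in Ms -> perfect_matching M
      & cover Ms = [set: edge G]].

(* [perfect_matching_index G t] means that tau(G) is defined and equal to t. *)
Definition perfect_matching_index (G : multigraph) (t : nat) : Prop :=
  covered_by_perfect_matchings G t /\
  forall n, covered_by_perfect_matchings G n -> t <= n.

(* Main.v *)
Require Import Defs.
From mathcomp Require Import all_boot zify.

Set Implicit Arguments.
Unset Strict Implicit.
Unset Printing Implicit Defensive.

(** The complement of [F] is a perfect matching, so it suffices to cover [F] by
    three perfect matchings [N1], [N2], [N3]. Even cycles of [F] are covered by
    alternating edges. On a good pair [C], [D] joined by [xx'], [yy'], [zz'],
    the three matchings use one of these edges each, together with the unique
    perfect matchings of [C] and [D] minus its ends. If [p], [q], [r] are the
    odd paths into which [x], [y], [z] divide [C], the matching that misses [x]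
    consists of the edges of odd index (from 0) of [p] and [r] and those of even
    index of [q], and cyclically for [y] and [z]; so the three of them cover [C]. *)

(** * Alternating selections from a sequence *)

Section Alternate.
Variable T : eqType.
Implicit Types (b : bool) (s : seq T).

Fixpoint alternate b s : seq T :=
  if s is a :: s' then
    if b then a :: alternate false s' else alternate true s'
  else [::].

Lemma alternate_subseq b s : subseq (alternate b s) s.
Proof.
elim: s b => [|a s IHs] [] //=; first by rewrite eqxx.
exact: subseq_trans (IHs true) (subseq_cons s a).
Qed.

Lemma mem_alternate b s a :
  (a \in s) = (a \in alternate b s) || (a \in alternate (~~ b) s).
Proof.
elim: s b => [|c s IHs] [] //=; rewrite !inE (IHs true) /=.
  by rewrite orbAC orbA.
by rewrite orbCA.
Qed.

End Alternate.

(** * Degrees as sums over edges, and degrees along walks and cycles *)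

Section Multigraph.
Variable G : multigraph.
Implicit Types (e : edge G) (v x y : vertex G) (S T : {set edge G}).
Implicit Types (p : seq (edge G * vertex G)) (s : seq (edge G)).

(** A loop counts twice at its vertex, as in [degree], so that degrees become sums over edges. *)
Definition mult e v : nat := ((ends e).1 == v) + ((ends e).2 == v).

Lemma joinsC e x y : joins e x y = joins e y x.
Proof. by rewrite /joins orbC. Qed.

Lemma joins_mult e x y v : joins e x y -> mult e v = (x == v) + (y == v).
Proof. by rewrite /mult => /orP[] /eqP -> //=; rewrite addnC. Qed.

Lemma mult_gt0_joins e v : 0 < mult e v -> exists w, joins e v w.
Proof.
rewrite /mult /joins; case: (ends e) => a b /=.
have [->|_] := eqVneq a v; first by exists b; rewrite eqxx.
have [->|//] := eqVneq b v; by exists a; rewrite eqxx orbT.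
Qed.

Lemma mult_end1 e : 0 < mult e (ends e).1.
Proof. by rewrite /mult eqxx. Qed.

Lemma degreeE S v : degree S v = \sum_(e in S) mult e v.
Proof.
rewrite big_split /= /degree.
congr (_ + _); rewrite -sum1dep_card big_mkcondr /=;
  by apply: eq_bigr => e _; case: (_ == v).
Qed.

Lemma degreeU S T v :
  [disjoint S & T] -> degree (S :|: T) v = degree S v + degree T v.
Proof. by move=> dST; rewrite !degreeE -bigU //=; apply: eq_bigl => e; rewrite inE. Qed.

Lemma degree1 e v : degree [set e] v = mult e v.
Proof. by rewrite degreeE big_set1. Qed.

Lemma degree_seq s v : uniq s -> degree [set e in s] v = \sum_(e <- s) mult e v.
Proof.
by move=> Us; rewrite degreeE big_uniq //=; apply: eq_bigl => e; rewrite inE.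
Qed.

Lemma on_cycleE S v : on_cycle S v = (0 < degree S v).
Proof.
rewrite degreeE lt0n sum_nat_eq0 negb_forall.
by apply: eq_existsb => e; rewrite negb_imply /mult addn_eq0 !eqb0 negb_and !negbK.
Qed.

Lemma on_cycleP S v :
  reflect (exists2 e, e \in S & 0 < mult e v) (on_cycle S v).
Proof.
apply: (iffP existsP) => [[e /andP[Se inc]]|[e Se inc]]; exists e => //.
  by move: inc; rewrite /mult; case/orP=> ->; rewrite ?addn1.
by rewrite Se; move: inc; rewrite /mult addn_gt0 !lt0b.
Qed.

Lemma on_cycleU S T v : on_cycle (S :|: T) v = on_cycle S v || on_cycle T v.
Proof.
apply/on_cycleP/orP => [[e /setUP[] Se inc]|[] /on_cycleP[e Se inc]].
- by left; apply/on_cycleP; exists e.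
- by right; apply/on_cycleP; exists e.
- by exists e; rewrite // inE Se.
- by exists e; rewrite // inE Se orbT.
Qed.

(** Each step counts one at both of its ends, so a visit counts two, except that the start and the
    end of the walk lose one each. The end term stands on the left to avoid subtraction. *)
Lemma degree_walk x p v : walk x p ->
  \sum_(e <- unzip1 p) mult e v + (last x (unzip2 p) == v)
  = (x == v) + (count_mem v (unzip2 p)).*2.
Proof.
elim: p x => [|[e y] p IHp] x /=; first by rewrite big_nil addn0.
case/andP=> /joins_mult-/(_ v) exy /IHp IH.
rewrite big_cons exy; move: IH; move: (count_mem _ _) => c.
by do !move: (nat_of_bool _) => ?; lia.
Qed.

(* Each visit of [v] is counted once, except that the two ends of the walk may
   be missed: the start if [b] is false, the end according to parity. *)
Lemma count_alternate b x p v : walk x p ->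
  \sum_(e <- alternate b (unzip1 p)) mult e v
    + ((~~ b) && (x == v)) + ((odd (size p) (+) b) && (last x (unzip2 p) == v))
  = (x == v) + count_mem v (unzip2 p).
Proof.
elim: p x b => [|[e y] p IHp] x b /=.
  by rewrite big_nil; case: b; rewrite /= ?addn0.
case/andP=> /joins_mult-/(_ v) exy /IHp{IHp}; move: (count_mem _ _) => c IH.
case: b; rewrite /= ?big_cons.
  move: (IH false) => /=; rewrite exy addbF addbT negbK.
  by do !move: (nat_of_bool _) => ?; lia.
move: (IH true) => /=; rewrite addbT addbF.
by do !move: (nat_of_bool _) => ?; lia.
Qed.

Lemma closed_path_degree x p v :
  closed_path x p -> degree [set e in unzip1 p] v = (v \in unzip2 p).*2.
Proof.
case/and5P=> _ xp /eqP lastx Uv Ue; rewrite degree_seq //.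
have := degree_walk v xp; rewrite lastx count_uniq_mem //.
by do !move: (nat_of_bool _) => ?; lia.
Qed.

Lemma cycle_degree S v : is_cycle S -> degree S v = (on_cycle S v).*2.
Proof.
case=> x [p [xp ->]]; rewrite on_cycleE (closed_path_degree v xp).
by case: (v \in _).
Qed.

Lemma walk_cat x p q :
  walk x (p ++ q) = walk x p && walk (last x (unzip2 p)) q.
Proof. by elim: p x => [|[e y] p IHp] x //=; rewrite IHp andbA. Qed.

Lemma walk_avoids x p v e :
  walk x p -> v \notin x :: unzip2 p -> e \in unzip1 p -> mult e v = 0.
Proof.
elim: p x => [|[f y] p IHp] x //=.
case/andP=> fxy yp; rewrite !inE !negb_or => /and3P[nvx nvy nvp].
case/predU1P=> [->|]; last by apply: IHp yp _; rewrite inE negb_or nvy.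
by rewrite (joins_mult v fxy) ![_ == v]eq_sym (negPf nvx) (negPf nvy).
Qed.

(** The first edge is incident with [x], which no later step touches, so it cannot recur. *)
Lemma path_edges_uniq x p : walk x p -> uniq (x :: unzip2 p) -> uniq (unzip1 p).
Proof.
elim: p x => [|[e y] p IHp] x //= /andP[exy yp] /andP[nxp Up].
rewrite (IHp y) // andbT; apply/negP => ep.
by have := walk_avoids yp nxp ep; rewrite (joins_mult x exy) eqxx.
Qed.


(** * Cycles in subgraphs of minimum degree two *)

Lemma min_degree2_cycle T e : e \in T ->
  (forall v, on_cycle T v -> 1 < degree T v) ->
  exists2 C, is_cycle C & C \subset T.
Proof.
move=> Te degT.
have loop f x : f \in T -> joins f x x -> exists2 C, is_cycle C & C \subset T.
  move=> Tf fxx; exists [set g in [:: f]]; last first.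
    by apply/subsetP => g; rewrite !inE => /eqP->.
  by exists x, [:: (f, x)]; split=> //; rewrite /closed_path /= fxx eqxx.
(* A path in [T] is prolonged at its first vertex until it closes up. It has [size p + 2] distinct
   vertices, which bounds the process; [n] is the remaining fuel. *)
have extend n x f y p : #|vertex G| < n + size p -> walk x ((f, y) :: p) ->
    uniq (x :: y :: unzip2 p) -> {subset f :: unzip1 p <= T} ->
    exists2 C, is_cycle C & C \subset T.
  elim: n x f y p => [|n IHn] x f y p ltVn xp Up sT.
    have := uniq_leq_size Up (fun v _ => mem_enum (vertex G) v).
    rewrite -cardE /= size_map => /ltnW/ltnW leV.
    by rewrite ltnNge leV in ltVn.
  have Tf : f \in T by apply: sT; rewrite mem_head.
  have fxy : joins f x y by case/andP: xp.
  have nxy : x != y by case/andP: Up; rewrite inE negb_or => /andP[].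
  have fx1 : mult f x = 1.
    by rewrite (joins_mult x fxy) eqxx eq_sym (negPf nxy).
  (* As [x != y], the edge [f] gives only one to the degree of [x], which is at least two. *)
  have [g [Tg nfg gx]] : exists g, [/\ g \in T, g != f & 0 < mult g x].
    have := degT x; rewrite on_cycleE degreeE (big_setD1 f) //= fx1 add1n.
    move=> /(_ isT); rewrite ltnS lt0n sum_nat_eq0 negb_forall.
    case/existsP=> g; rewrite negb_imply !inE -lt0n => /andP[/andP[nfg Tg] gx].
    by exists g.
  have [w gxw] := mult_gt0_joins gx.
  have [wp|nwp] := boolP (w \in x :: y :: unzip2 p); last first.
    apply: (IHn w g x ((f, y) :: p)).
    - by rewrite /= addnS -addSn.
    - by rewrite /= joinsC gxw.
    - by rewrite /= in Up *; rewrite nwp.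
    - by move=> h /predU1P[->|/sT].
  have [wx|nwx] := eqVneq w x; first by apply: (loop g x Tg); rewrite -{2}wx.
  have {wp} : w \in unzip2 ((f, y) :: p) by move: wp; rewrite inE (negPf nwx).
  have Uep := path_edges_uniq xp Up.
  (* The cycle must not repeat an edge: those after [f] avoid [x], but [g] does not. *)
  have ng : g \notin unzip1 ((f, y) :: p).
    rewrite inE (negPf nfg) /=; apply/negP => gp.
    case/andP: xp => _ yp; have nxp : x \notin y :: unzip2 p by case/andP: Up.
    by rewrite (walk_avoids yp nxp gp) in gx.
  rewrite {1}/unzip2 => /mapP[[h w'] hw /= Dw]; rewrite -{}Dw in hw.
  move: {IHn ltVn} xp Up sT Uep ng; rewrite -![x :: y :: _]/(x :: unzip2 ((f, y) :: p)).
  rewrite -![f :: _]/(unzip1 ((f, y) :: p)) => xp Up sT Uep ng.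
  (* The path is cut where it reaches [w]; the edge [g] from [w] to [x] closes the initial segment
     to a cycle. *)
  case/splitPr: hw xp Up sT Uep ng => p1 p2.
  rewrite -cat_rcons walk_cat /unzip1 /unzip2 !map_cat -cat_cons !cat_uniq mem_cat.
  case/andP=> xq _ /andP[Uq _] sT /andP[Ueq _] /norP[ngq _].
  exists [set i in unzip1 ((g, x) :: rcons p1 (h, w))]; last first.
    apply/subsetP => i; rewrite inE => /predU1P[->|iq] //.
    by apply: sT; rewrite mem_cat; apply/orP; left.
  exists w, ((g, x) :: rcons p1 (h, w)); split=> //.
  apply/and5P; split=> //.
  - by rewrite /= joinsC gxw.
  - by rewrite /unzip2 /= map_rcons last_rcons.
  - by rewrite /= in ngq *; rewrite ngq.
have [y exy] := mult_gt0_joins (mult_end1 e).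
have [Dy|nxy] := eqVneq (ends e).1 y; first by apply: (loop e y Te); rewrite -{1}Dy.
apply: (extend #|vertex G|.+1 (ends e).1 e y [::]); rewrite /= ?addn0 ?exy ?inE ?nxy //.
by move=> h; rewrite inE => /eqP->.
Qed.

(** * Components of a 2-factor *)

Section TwoFactor.
Variable F : {set edge G}.
Hypothesis factorF : two_factor F.

(** Describes the unions of components of [F] without defining components. *)
Definition closed_in S : Prop :=
  S \subset F /\
  forall e v, e \in F -> 0 < mult e v -> on_cycle S v -> e \in S.

Lemma degreeF v : degree F v = 2.
Proof. by move/forallP: factorF => /(_ v) /eqP. Qed.

Lemma degreeD S v : S \subset F -> degree S v + degree (F :\: S) v = 2.
Proof.
move=> sSF; rewrite -degreeU ?setDUr ?setUDr; last first.
  by rewrite disjoints_subset; apply/subsetP => e; rewrite !inE => ->.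
rewrite -(degreeF v); congr degree.
by apply/setP => e; rewrite !inE; case: (boolP (e \in S)) => //= /(subsetP sSF)->.
Qed.

(** A cycle already has degree two at each of its vertices, which leaves degree 0 for [F :\: C]. *)
Lemma cycle_closed C : is_cycle C -> C \subset F -> closed_in C.
Proof.
move=> cycC sCF; split=> // e v Fe inc vC; apply/negPn/negP => nCe.
have := degreeD v sCF; rewrite (cycle_degree v cycC) vC.
suff : on_cycle (F :\: C) v by rewrite on_cycleE; case: (degree _ v).
by apply/on_cycleP; exists e; rewrite // inE nCe.
Qed.

Lemma closed_walk S x p : closed_in S -> walk x p -> {subset unzip1 p <= F} ->
  on_cycle S x -> {subset unzip1 p <= S} /\ on_cycle S (last x (unzip2 p)).
Proof.
case=> _ clS; elim: p x => [|[e y] p IHp] x //= /andP[exy yp] sF xS.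
have Se : e \in S.
  by apply: clS xS; rewrite ?sF ?mem_head // (joins_mult x exy) eqxx.
have yS : on_cycle S y.
  by apply/on_cycleP; exists e; rewrite // (joins_mult y exy) eqxx addn1.
have [|sS lastS] := IHp y yp _ yS; first by move=> f pf; rewrite sF // inE pf orbT.
by split=> // f /predU1P[->|/sS].
Qed.

Lemma closed_walk_last S x p e : closed_in S -> walk x p ->
  {subset unzip1 p <= F} -> e \in unzip1 p -> e \in S ->
  on_cycle S (last x (unzip2 p)).
Proof.
move=> clS; elim: p x => [|[f y] p IHp] x //= /andP[fxy yp] sF.
have sFp : {subset unzip1 p <= F} by move=> g pg; rewrite sF // inE pg orbT.
case/predU1P=> [->|ep] Se; last exact: IHp.
apply: (proj2 (closed_walk clS yp sFp _)).
by apply/on_cycleP; exists f; rewrite // (joins_mult y fxy) eqxx addn1.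
Qed.

(** From [e] on, the walk around [C] stays in [S] until it returns to its start; a second turn from
    there puts every edge in [S]. *)
Lemma closed_cycle_sub S C e : closed_in S -> is_cycle C -> C \subset F ->
  e \in C -> e \in S -> C \subset S.
Proof.
move=> clS [x [p [/and5P[_ xp /eqP lastx _ _] ->]]] sCF.
have sF : {subset unzip1 p <= F}.
  by move=> f pf; apply: (subsetP sCF); rewrite inE.
rewrite inE => pe Se; have := closed_walk_last clS xp sF pe Se.
rewrite lastx => /(closed_walk clS xp sF)[sS _].
by apply/subsetP => f; rewrite inE => /sS.
Qed.

(** Both cycles are closed in [F], so a common edge would make each contain the other. *)
Lemma distinct_cycles_disjoint C D : is_cycle C -> is_cycle D ->
  C \subset F -> D \subset F -> C != D -> [disjoint C & D].
Proof.
move=> cycC cycD sCF sDF; apply: contraNT => /pred0Pn[e /andP[/= Ce De]].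
have [clC clD] := (cycle_closed cycC sCF, cycle_closed cycD sDF).
rewrite eqEsubset (closed_cycle_sub clD cycC sCF Ce) //.
by rewrite (closed_cycle_sub clC cycD sDF De).
Qed.

Lemma closed_disjoint S T v : closed_in S -> closed_in T -> [disjoint S & T] ->
  ~~ (on_cycle S v && on_cycle T v).
Proof.
move=> [_ clS] [sTF _] dST; apply/negP => /andP[vS /on_cycleP[e Te inc]].
by have := clS e v (subsetP sTF e Te) inc vS; rewrite (disjointFl dST Te).
Qed.

Lemma closedU S T : closed_in S -> closed_in T -> closed_in (S :|: T).
Proof.
move=> [sSF clS] [sTF clT]; split=> [|e v Fe inc]; first by rewrite subUset sSF.
by rewrite on_cycleU inE => /orP[/(clS e v Fe inc)|/(clT e v Fe inc)] ->; rewrite ?orbT.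
Qed.

End TwoFactor.

(** * Matchings of the vertices of a subgraph, and coverings by three of them *)

Definition spans S N : Prop := forall v, degree N v = on_cycle S v.

(** Written without subtraction; at [v = x] the equation forces [x] to lie on [S] and to be missed
    by [N]. *)
Definition spans_but S x N : Prop :=
  forall v, degree N v + (x == v) = on_cycle S v.

(** The matchings may leave [S], as they use the joining edges of a good pair. Hence the inclusion
    instead of an equality, and hence [spans] prescribes degrees only. *)
Definition coverable S : Prop :=
  exists N1 N2 N3, [/\ spans S N1, spans S N2, spans S N3
    & S \subset N1 :|: N2 :|: N3].

Lemma disjoint_degree S T : (forall v, degree S v = 0 \/ degree T v = 0) ->
  [disjoint S & T].
Proof.
move=> dST; apply/pred0P => e; apply/negP => /andP[/= Se Te].
have [ontoS ontoT] : on_cycle S (ends e).1 /\ on_cycle T (ends e).1.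
  by split; apply/on_cycleP; exists e; rewrite ?mult_end1.
by move: ontoS ontoT; rewrite !on_cycleE; case: (dST (ends e).1) => ->.
Qed.

(** As [M] and [N] may leave [S] and [T], their disjointness comes from degrees: at every vertex one
    of them has degree 0. *)
Lemma spansU S T M N : (forall v, ~~ (on_cycle S v && on_cycle T v)) ->
  spans S M -> spans T N -> spans (S :|: T) (M :|: N).
Proof.
move=> dST sM sN v; have /negPf := dST v.
rewrite degreeU ?sM ?sN ?on_cycleU; first by do 2!case: on_cycle.
apply: disjoint_degree => w; rewrite sM sN; have /negPf := dST w.
by do 2!case: on_cycle => //=; move=> _; [right | left | left].
Qed.

Lemma coverableU S T : (forall v, ~~ (on_cycle S v && on_cycle T v)) ->
  coverable S -> coverable T -> coverable (S :|: T).
Proof.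
move=> dST [M1 [M2 [M3 [sM1 sM2 sM3 covS]]]] [N1 [N2 [N3 [sN1 sN2 sN3 covT]]]].
exists (M1 :|: N1), (M2 :|: N2), (M3 :|: N3); split; try exact: spansU.
apply/subsetP => e; rewrite !inE => /orP[/(subsetP covS)|/(subsetP covT)];
  by rewrite !inE => /orP[/orP[]|] ->; rewrite ?orbT.
Qed.

(** The only vertices of [C] and [D] that [M] and [N] miss are [x] and [y], the ends of [e]. *)
Lemma spans_joined C D x y e M N :
  (forall v, ~~ (on_cycle C v && on_cycle D v)) -> joins e x y ->
  spans_but C x M -> spans_but D y N -> spans (C :|: D) (e |: (M :|: N)).
Proof.
move=> dCD exy sM sN v.
have dMN : [disjoint M & N].
  apply: disjoint_degree => w; have /negPf := dCD w; move: (sM w) (sN w).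
  by do 2!case: on_cycle => //=; case: (degree M w) => [|?];
    case: (degree N w) => [|?] //=; auto.
have nMe : e \notin M.
  apply/negP => Me; have : on_cycle M x.
    by apply/on_cycleP; exists e; rewrite // (joins_mult x exy) eqxx.
  by move: (sM x); rewrite (on_cycleE M) eqxx addn1; case: degree => // n; case: on_cycle.
have nNe : e \notin N.
  apply/negP => Ne; have : on_cycle N y.
    by apply/on_cycleP; exists e; rewrite // (joins_mult y exy) eqxx addn1.
  by move: (sN y); rewrite (on_cycleE N) eqxx addn1; case: degree => // n; case: on_cycle.
rewrite degreeU; last by rewrite disjoints1 inE negb_or nMe.
rewrite degreeU // degree1 (joins_mult v exy) addnACA.
rewrite ![(_ == v) + _]addnC sM sN on_cycleU; have /negPf := dCD v.
by do 2!case: on_cycle.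
Qed.

Lemma even_cycle_coverable C : is_cycle C -> ~~ odd #|C| -> coverable C.
Proof.
move=> cycC; have degC v := cycle_degree v cycC.
case: cycC degC => x [p [xp defC]] degC evenC.
have [_ wp /eqP lastx Uv Ue] := and5P xp.
have evenp : ~~ odd (size p).
  by move: evenC; rewrite defC cardsE (card_uniqP Ue) size_map.
(* The walk is closed and even, so exactly one of the two corrections in [count_alternate] is
   active, and it cancels the term of the start [x]. *)
have spans_alt b : spans C [set e in alternate b (unzip1 p)].
  move=> v; rewrite degree_seq ?(subseq_uniq (alternate_subseq _ _)) //.
  have := degC v; rewrite {1}defC (closed_path_degree v xp) => /double_inj <-.
  have := count_alternate b v wp; rewrite lastx (negPf evenp) count_uniq_mem //.
  by case: b; case: (x == v) => /=; do !move: (nat_of_bool _) => ?; lia.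
exists [set e in alternate true (unzip1 p)], [set e in alternate false (unzip1 p)].
(* Two matchings cover an even cycle; the third repeats the first. *)
exists [set e in alternate true (unzip1 p)]; split=> //.
apply/subsetP => e; rewrite defC !inE (mem_alternate true) => /orP[] -> //.
by rewrite orbT.
Qed.

Lemma odd_division_matchings C x y z : is_cycle C -> odd_division C x y z ->
  exists N1 N2 N3, [/\ spans_but C x N1, spans_but C y N2, spans_but C z N3
    & C \subset N1 :|: N2 :|: N3].
Proof.
move=> cycC [_ _ _ _ [p [q [r [[xp yq zr] [Ue defC op oq or]]]]]].
case/and3P: xp => xp /eqP lastp _; case/and3P: yq => yq /eqP lastq _.
case/and3P: zr => zr /eqP lastr _.
pose N b c d := [set e in alternate b (unzip1 p) ++ alternate c (unzip1 q)
                         ++ alternate d (unzip1 r)].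
(* On an odd path the selection with flag [true] meets both ends and that with [false] neither, so
   the corrections come in pairs. *)
have degN b c d v : degree (N b c d) v
    + ((~~ b) && (x == v)) + ((~~ b) && (y == v))
    + ((~~ c) && (y == v)) + ((~~ c) && (z == v))
    + ((~~ d) && (z == v)) + ((~~ d) && (x == v))
  = on_cycle C v + (x == v) + (y == v) + (z == v).
  have subN : subseq (alternate b (unzip1 p) ++ alternate c (unzip1 q)
                       ++ alternate d (unzip1 r)) (unzip1 (p ++ q ++ r)).
    by rewrite /unzip1 !map_cat !cat_subseq ?alternate_subseq.
  (* Compared with [cycle_degree], this count shows that the closed walk visits each vertex of [C]
     once. *)
  have := degree_walk v (_ : walk x (p ++ q ++ r)).
  rewrite !walk_cat lastp lastq xp yq zr => /(_ isT).
  rewrite -(degree_seq v Ue) -defC (cycle_degree v cycC) /unzip2 !map_cat !last_cat.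
  rewrite lastp lastq lastr addnC => /addnI/double_inj ->.
  rewrite degree_seq ?(subseq_uniq subN Ue) // !big_cat /= !count_cat.
  have := count_alternate b v xp; have := count_alternate c v yq.
  have := count_alternate d v zr.
  rewrite lastp lastq lastr op oq or !addTb.
  do !move: (count_mem _ _) => ?; do !move: (nat_of_bool _) => ?.
  do !move: (\sum_(e <- alternate _ _) mult e v) => ?; lia.
(* The missed vertex is the one where two flags [false] meet: [x] lies between [r] and [p], [y]
   between [p] and [q], [z] between [q] and [r]. Each path receives both flags, so [C] is
   covered. *)
exists (N false true false), (N false false true), (N true false false).
split; try by move=> v; have := degN false true false v;
  have := degN false false true v; have := degN true false false v => /=;
  do !move: (nat_of_bool _) => ?; lia.
apply/subsetP => e; rewrite {1}defC !inE /unzip1 !map_cat !mem_cat.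
rewrite (mem_alternate true (map _ p)) (mem_alternate true (map _ q)).
rewrite (mem_alternate true (map _ r)) /=.
by do !case: (e \in _).
Qed.

Lemma good_pair_coverable C D : (forall v, ~~ (on_cycle C v && on_cycle D v)) ->
  good_pair C D -> coverable (C :|: D).
Proof.
move=> dCD [[cycC _] [cycD _] _ [x [y [z [x' [y' [z' [joined divC divD]]]]]]]].
case: joined => e1 [e2 [e3 [_ j1 j2 j3]]].
have [M1 [M2 [M3 [sM1 sM2 sM3 covC]]]] := odd_division_matchings cycC divC.
have [N1 [N2 [N3 [sN1 sN2 sN3 covD]]]] := odd_division_matchings cycD divD.
exists (e1 |: (M1 :|: N1)), (e2 |: (M2 :|: N2)), (e3 |: (M3 :|: N3)).
split; first exact: spans_joined j1 sM1 sN1.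
- exact: spans_joined j2 sM2 sN2.
- exact: spans_joined j3 sM3 sN3.
apply/subsetP => e; rewrite !inE => /orP[/(subsetP covC)|/(subsetP covD)];
  by rewrite !inE => /orP[/orP[]|] ->; rewrite ?orbT.
Qed.

(** * Assembling the 2-factor from blocks *)

Section Pairing.
Variables (F : {set edge G}) (P : {set {set {set edge G}}}).
Hypotheses (factorF : two_factor F) (pairP : good_pairing F P).

(* A union of even cycles and pairs: a block never splits a pair. *)
Definition block K : Prop :=
  [/\ closed_in F K, coverable K
    & forall B, B \in P -> cover B \subset K \/ [disjoint cover B & K]].

Lemma block0 : block set0.
Proof.
have none v : on_cycle set0 v = false.
  by apply/on_cycleP => -[e]; rewrite inE.
split; first by split=> [|e v _ _]; rewrite ?sub0set // none.
- exists set0, set0, set0; split; rewrite ?sub0set // => v;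
    by rewrite degreeE big_set0 none.
- by move=> B _; right; rewrite disjoint_sym disjoints_subset sub0set.
Qed.

Lemma blockU K L : block K -> block L -> [disjoint K & L] -> block (K :|: L).
Proof.
move=> [clK covK PK] [clL covL PL] dKL; split; first exact: closedU.
  by apply: coverableU => // v; apply: closed_disjoint clK clL dKL.
move=> B PB; have [sBK|dBK] := PK B PB.
  by left; apply: subset_trans sBK (subsetUl _ _).
have [sBL|dBL] := PL B PB; first by left; apply: subset_trans sBL (subsetUr _ _).
by right; rewrite disjoints_subset setCU subsetI -!disjoints_subset dBK.
Qed.

Lemma pair_cycles B C : B \in P -> C \in B -> odd_cycle C /\ C \subset F.
Proof.
by case: pairP => _ coverP _ PB BC; apply/coverP/bigcupP; exists B.
Qed.

Lemma disjoint_cover (B : {set {set edge G}}) (K : {set edge G}) :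
  (forall C, C \in B -> [disjoint C & K]) -> [disjoint cover B & K].
Proof.
move=> dBK; rewrite disjoints_subset; apply/bigcupsP => C /dBK.
by rewrite disjoints_subset.
Qed.

(** The paired cycles are odd, so they differ from [C] and are disjoint from it. *)
Lemma even_cycle_block C : is_cycle C -> C \subset F -> ~~ odd #|C| -> block C.
Proof.
move=> cycC sCF evenC; split; first exact: cycle_closed.
  exact: even_cycle_coverable.
move=> B PB; right; apply: disjoint_cover => D BD.
have [[cycD oddD] sDF] := pair_cycles PB BD.
by apply: (distinct_cycles_disjoint factorF) => //; apply: contraNneq evenC => <-.
Qed.

Lemma pair_block B : B \in P -> block (cover B).
Proof.
move=> PB; have [trivP _ goodP] := pairP.
have [C [D [defB goodCD]]] := goodP B PB.
have [BC BD] : C \in B /\ D \in B by rewrite defB !inE !eqxx orbT.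
have [[[cycC _] sCF] [[cycD _] sDF]] := (pair_cycles PB BC, pair_cycles PB BD).
have nCD : C != D by case: goodCD.
have [clC clD] := (cycle_closed factorF cycC sCF, cycle_closed factorF cycD sDF).
have coverB : cover B = C :|: D by rewrite defB /cover bigcup_setU !big_set1.
rewrite coverB; split; first exact: closedU.
  apply: good_pair_coverable goodCD => v; apply: closed_disjoint clC clD _.
  exact: (distinct_cycles_disjoint factorF).
move=> B' PB'; have [->|nBB'] := eqVneq B' B; first by left; rewrite coverB.
(* Cycles of different pairs are distinct because [P] is a disjoint family, and distinct cycles of
   [F] share no edge. *)
right; rewrite -coverB; apply: disjoint_cover => E B'E.
rewrite disjoint_sym; apply: disjoint_cover => E' BE'.
have [[cycE _] sEF] := pair_cycles PB' B'E.
have [[cycE' _] sE'F] := pair_cycles PB BE'.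
apply: (distinct_cycles_disjoint factorF) => //.
apply: contraTneq BE' => ->; apply/negP => BE.
by have /trivIsetP/(_ B' B PB' PB nBB') := trivP => /disjointFl/(_ BE); rewrite B'E.
Qed.

(** Since [S] is closed, [F :\: S] has degree two at each vertex it touches and so contains a cycle.
    An even cycle is a block by itself; an odd one brings its whole pair. *)
Lemma next_block S : block S -> S != F ->
  exists K, [/\ block K, [disjoint S & K] & K != set0].
Proof.
move=> [[sSF clS] _ PS] nSF.
have [e] : exists e, e \in F :\: S.
  by apply/set0Pn; rewrite setD_eq0; apply: contra nSF => sFS; rewrite eqEsubset sSF.
case/min_degree2_cycle=> [v /on_cycleP[f /setDP[Ff nSf] inc]|C cycC].
  have : ~~ on_cycle S v by apply: contra nSf; apply: clS inc.
  by rewrite on_cycleE -eqn0Ngt => /eqP S0; rewrite -(degreeD factorF v sSF) S0.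
rewrite subsetD => /andP[sCF dCS].
have nC0 : C != set0.
  case: cycC => x [[|a p] [xp ->]]; first by case/and5P: xp.
  by apply/set0Pn; exists a.1; rewrite inE mem_head.
have [oddC|evenC] := boolP (odd #|C|); last first.
  by exists C; split; rewrite // 1?disjoint_sym //; apply: even_cycle_block.
have /bigcupP[B PB BC] : C \in cover P by case: pairP => _ coverP _; apply/coverP.
have sCB : C \subset cover B by apply: bigcup_sup BC.
exists (cover B); split; first exact: pair_block.
  (* The pair cannot lie inside [S], since [C] is nonempty and misses [S]. *)
  rewrite disjoint_sym; case: (PS B PB) => // sBS.
  case/set0Pn: nC0 => f Cf; have := disjointFr dCS Cf.
  by rewrite (subsetP sBS) // (subsetP sCB).
by apply: contra nC0 => /eqP B0; rewrite -subset0 -B0.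
Qed.

(** Blocks are added to the empty one until [F] is reached; each nonempty addition lowers
    [#|F :\: S|]. *)
Lemma factor_coverable : coverable F.
Proof.
suff extend n S : block S -> #|F :\: S| <= n -> coverable F.
  exact: extend block0 (leqnn _).
elim: n S => [|n IHn] S blS leSn; have [defS|nSF] := eqVneq S F.
- by case: blS; rewrite defS.
- move: leSn; rewrite leqn0 cards_eq0 setD_eq0 => sFS.
  by case/negP: nSF; rewrite eqEsubset sFS; case: blS => [[->]].
- by case: blS; rewrite defS.
have [K [blK dSK nK0]] := next_block blS nSF.
apply: (IHn (S :|: K)); first exact: blockU.
rewrite -ltnS; apply: leq_trans leSn; apply: proper_card.
rewrite properE setDS ?subsetUl //=; apply/subsetPn.
case/set0Pn: nK0 => e Ke; exists e; rewrite !inE ?Ke ?orbT //.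
by rewrite (disjointFl dSK Ke); case: blK => -[/subsetP->].
Qed.

End Pairing.

End Multigraph.

(** * Perfect matching index at most four *)

Theorem theorem3p5 (G : multigraph) (cubicG : cubic G)
    (F : {set edge G}) (factorF : two_factor F)
    (pairable : exists P : {set {set {set edge G}}}, good_pairing F P) :
  exists t : nat, perfect_matching_index G t /\ t <= 4.
Proof.
have [P pairP] := pairable.
have [N1 [N2 [N3 [sN1 sN2 sN3 covF]]]] := factor_coverable factorF pairP.
(* Every vertex has degree two in [F], so [N] meets every vertex exactly once. *)
have matching N : spans F N -> perfect_matching N.
  by move=> sN; apply/forallP => v; rewrite sN on_cycleE degreeF.
have matchingC : perfect_matching (~: F).
  apply/forallP => v; have dF : [disjoint F & ~: F] by rewrite disjoints_subset setCK.
  have := degreeU v dF; rewrite setUCr (degreeF factorF).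
  by move/forallP: cubicG => /(_ v)/eqP-> /eqP; rewrite eqSS eqSS eq_sym.
(* A boolean form of the covering property, to which [ex_minnP] applies. *)
pose covers n := [exists Ms : {set {set edge G}}, [&& #|Ms| == n,
  [forall (M | M \in Ms), perfect_matching M] & cover Ms == [set: edge G]]].
have coversP n : reflect (covered_by_perfect_matchings G n) (covers n).
  apply: (iffP existsP) => [[Ms /and3P[/eqP ? /forall_inP ? /eqP ?]]|[Ms [? ? ?]]];
    exists Ms; first by [].
  by apply/and3P; split; [apply/eqP | apply/forall_inP | apply/eqP].
(* The four matchings may coincide, so this set can have fewer than four elements; its cardinal only
   bounds the minimum. *)
pose Ms := ~: F |: (N1 |: (N2 |: [set N3])).
have coversMs : covers #|Ms|.
  apply/coversP; exists Ms; split=> // [M|].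
    by rewrite !inE => /or4P[] /eqP-> //; apply: matching.
  apply/eqP; rewrite -subTset; apply/subsetP => e _.
  rewrite /cover !bigcup_setU !big_set1 !inE.
  by case: (boolP (e \in F)) => //= /(subsetP covF); rewrite !inE -orbA.
case: (ex_minnP (ex_intro covers _ coversMs)) => t /coversP cov_t min_t.
exists t; split; first by split=> // n /coversP/min_t.
by apply: leq_trans (min_t _ coversMs) _; rewrite !cardsU1 cards1; do !case: (_ \notin _).
Qed.
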